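(* ($q$-Cassini's formula) Let $(M_n(\cdot,q))_{n\ge0}$ be the generalized $q$-Morgan-Voyce polynomials with arbitrary initial conditions $M_0(\cdot,q)$, $M_1(\cdot,q)$, and let $z=\frac{x+1+q}{\sqrt{q}}-1-q$. For every integer $n\ge 2$, $$M_{n+1}(x,q)M_{n-1}(z,q)-\sqrt{q}\,M_{n}(x,q)M_{n}(z,q)=q^{\frac{(n-1)^{2}}{2}}\left(M_{2}(x,q)M_{0}(z,q)-\sqrt{q}\,M_{1}(x,q)M_{1}(z,q)\right).$$
   Context: Here $x,q$ are complex numbers with $q\neq 0,1$, $\sqrt q$ is a fixed square root of $q$, and half-integer powers mean $q^{m/2}=(\sqrt q)^m$ for integers $m$. The generalized $q$-Morgan-Voyce polynomials are defined, for arbitrary initial functions $M_0(\cdot,q),M_1(\cdot,q)$ of the first variable, by $M_{n}(t,q)=(t+1+q)M_{n-1}(t,q)-q^{n-2}M_{n-2}(t,q)$ for $n\ge 2$ and all $t$; $M_n(z,q)$ is the value at $t=z$ (with initial values $M_0(z,q)$, $M_1(z,q)$). *)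

(* Defs.v *)
From mathcomp Require Import all_boot all_order all_algebra.
From mathcomp Require Import reals complex.

Set Implicit Arguments.
Unset Strict Implicit.
Unset Printing Implicit Defensive.

Import GRing.Theory Num.Theory.
Local Open Scope ring_scope.
Local Open Scope complex_scope.

(* Generalized q-Morgan-Voyce polynomials M_n(t, q) with initial functions
   M_0(t, q), M_1(t, q).  The recurrence is shifted to n = k + 2, so that its
   coefficient q^(n-2) is q ^+ k. *)
Fixpoint qMorganVoyce (R : realType) (M0 M1 : R[i] -> R[i] -> R[i])
    (n : nat) (t q : R[i]) {struct n} : R[i] :=
  match n with
  | 0%N => M0 t q
  | (n'.+1)%N =>
    match n' with
    | 0%N => M1 t q
    | (k.+1)%N => (t + 1 + q) * qMorganVoyce M0 M1 n' t q
                  - q ^+ k * qMorganVoyce M0 M1 k t q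
    end
  end.

(* Main.v *)
(* With a_n = M_n(x, q) and b_n = M_n(z, q), the choice of z makes the
   recurrence coefficient of b equal to that of a divided by s.  Expanding
   a_(n+1) and b_n in a_(n+1) b_(n-1) - s a_n b_n, the terms in a_n b_(n-1)
   cancel and what remains is s ^+ (2n - 3) times the preceding difference;
   the exponents 2n - 3 add up to (n - 1)^2. *)

Require Import Defs.
From mathcomp Require Import all_boot all_order all_algebra.
From mathcomp Require Import reals complex ring.

Set Implicit Arguments.
Unset Strict Implicit.
Unset Printing Implicit Defensive.

Import GRing.Theory Num.Theory.
Local Open Scope ring_scope.
Local Open Scope complex_scope.

Lemma qMorganVoyceSS (R : realType) (M0 M1 : R[i] -> R[i] -> R[i])
    (n : nat) (t q : R[i]) :
  qMorganVoyce M0 M1 n.+2 t q =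
  (t + 1 + q) * qMorganVoyce M0 M1 n.+1 t q - q ^+ n * qMorganVoyce M0 M1 n t q.
Proof. by []. Qed.

(** Here [k] stands for n - 1, so the induction starts from a trivial identity at [k = 0]. *)
Lemma cassini_recurrence (F : fieldType) (A s : F) (a b : nat -> F) :
  s != 0 ->
  (forall k, a k.+2 = A * a k.+1 - (s ^+ 2) ^+ k * a k) ->
  (forall k, b k.+2 = A / s * b k.+1 - (s ^+ 2) ^+ k * b k) ->
  forall k, a k.+2 * b k - s * a k.+1 * b k.+1
            = s ^+ (k ^ 2) * (a 2%N * b 0%N - s * a 1%N * b 1%N).
Proof.
move=> s0 aE bE; elim=> [|k IHk]; first by rewrite expr0 mul1r.
(* Consecutive squares differ by [2 * k + 1], the power of [s] gained in one step. *)
have -> : (k.+1 ^ 2 = (2 * k).+1 + k ^ 2)%N by ring.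
rewrite exprD -[RHS]mulrA -IHk (aE k.+1) (bE k).
(* All powers are written through [s] and [(s ^+ 2) ^+ k], so that [field] sees the same atoms on
   both sides. *)
rewrite [s ^+ (2 * k).+1]exprS exprM [_ ^+ k.+1]exprS.
by field.
Qed.

(* s is the fixed square root of q, so q^(m/2) is s ^+ m. *)
Theorem theorem27 (R : realType) (M0 M1 : R[i] -> R[i] -> R[i])
    (x q s z : R[i]) (hq0 : q != 0) (hq1 : q != 1) (hs : s ^+ 2 = q)
    (hz : z = (x + 1 + q) / s - 1 - q) (n : nat) (hn : (2 <= n)%N) :
  let M := qMorganVoyce M0 M1 in
  M n.+1 x q * M n.-1 z q - s * M n x q * M n z q
  = s ^+ (n.-1 ^ 2) * (M 2%N x q * M 0%N z q - s * M 1%N x q * M 1%N z q).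
Proof.
case: n hn => [//|k] _ M.
have s0 : s != 0 by move: hq0; rewrite -hs expf_eq0.
have zE : z + 1 + q = (x + 1 + q) / s by rewrite hz; ring.
(* [x] and [z] are fixed, so only the index varies and the initial functions enter as plain
   values. *)
apply: (cassini_recurrence (A := x + 1 + q)
  (a := fun j => M j x q) (b := fun j => M j z q)) => // j.
  by rewrite hs /M qMorganVoyceSS.
by rewrite hs /M qMorganVoyceSS zE.
Qed.
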